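(* There exist absolute constants $c>0$ and $\delta>0$ such that for every finite simple undirected graph $G=(V,E)$ with $V\ne\emptyset$: (i) for every coalition game $\mathcal G$ over $G$, $\dfrac{\rho^f(\mathcal G)}{\rho(\mathcal G)}\le\tau(G)$; (ii) there exists a coalition game $\mathcal G$ over $G$ with $\dfrac{\rho^f(\mathcal G)}{\rho(\mathcal G)}\ge c\cdot\tau(G)^{\delta}$.
   Context: Coalition game over an interaction graph: for a finite simple undirected graph $G=(V,E)$, a coalition game $\mathcal G$ over $G$ is given by a valuation $v:2^V\to\mathbb Z_{\ge 0}$ such that $v(\emptyset)=0$, $v(S)=0$ whenever the induced subgraph $G[S]$ is disconnected, and $v$ is not identically zero. Define $\rho^f(\mathcal G)=\max\{\sum_{S\subseteq V}v(S)y_S : y\ge 0,\ \sum_{S\ni i}y_S\le 1\ \forall i\in V\}$ and $\rho(\mathcal G)$ the same maximum over $y\in\{0,1\}^{2^V}$ (i.e. the maximum of $\sum v(S)$ over families of pairwise disjoint subsets $S$). Thicket: a finite collection $\mathcal H$ of nonempty subsets of $V$ such that each member induces a connected subgraph of $G$ and any two members intersect. A hitting set of $\mathcal H$ is a vertex set meeting every member; the hitting size $\tau(\mathcal H)$ is the minimum cardinality of a hitting set. The thicket number $\tau(G)$ is the maximum of $\tau(\mathcal H)$ over all thickets $\mathcal H$ of $G$. *)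

(* Defs.v *)
From mathcomp Require Import all_boot.
From Stdlib Require Import Reals.
Set Implicit Arguments. Unset Strict Implicit. Unset Printing Implicit Defensive.

Section Defs.
Variable V : finType.
Variable e : rel V.

Definition induced (S : {set V}) : rel V :=
  fun x y => [&& e x y, x \in S & y \in S].

Definition connected_in (S : {set V}) : bool :=
  (S != set0) && [forall x in S, forall y in S, connect (induced S) x y].

Definition coalition_game (v : {set V} -> nat) : Prop :=
  [/\ v set0 = 0%N,
      (forall S : {set V}, ~~ connected_in S -> v S = 0%N)
    & exists S : {set V}, v S <> 0%N].

Definition packing (P : {set {set V}}) : bool :=
  [forall S in P, forall T in P, (S != T) ==> [disjoint S & T]].

Definition rho (v : {set V} -> nat) : nat :=
  \max_(P : {set {set V}} | packing P) \sum_(S in P) v S.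

(* feasible fractional solutions y of the LP defining rho^f *)
Definition lp_feasible (y : {set V} -> R) : Prop :=
  (forall S, (0 <= y S)%R) /\
  (forall i : V, (\big[Rplus/0%R]_(S : {set V} | i \in S) y S <= 1)%R).

Definition lp_value (v : {set V} -> nat) (y : {set V} -> R) : R :=
  \big[Rplus/0%R]_(S : {set V}) (INR (v S) * y S)%R.

Definition thicket (H : {set {set V}}) : bool :=
  [forall S in H, (S != set0) && connected_in S] &&
  [forall S in H, forall T in H, ~~ [disjoint S & T]].

Definition hitting (H : {set {set V}}) (X : {set V}) : bool :=
  [forall S in H, ~~ [disjoint X & S]].

(* hitting size: minimum cardinality of a hitting set (the whole vertex set
   hits every thicket, so #|V| is a valid upper default) *)
Definition hitting_size (H : {set {set V}}) : nat :=
  \big[minn/#|V|]_(X : {set V} | hitting H X) #|X|.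

Definition thicket_number : nat :=
  \max_(H : {set {set V}} | thicket H) hitting_size H.

End Defs.

(* Main.v *)
Require Import Defs.
From HB Require Import structures.
From mathcomp Require Import all_boot.
From Stdlib Require Import Reals Lra.
From mathcomp Require Import zify.
Set Implicit Arguments. Unset Strict Implicit. Unset Printing Implicit Defensive.

(* Upper bound. Let k be the thicket number. By a duality in the style of Bellenbaum
   and Diestel, the graph has a tree of bags of size at most k in which the bags
   containing a given vertex form a subtree and adjacent vertices lie in equal or
   adjacent bags: by induction on the thicket H, from the largest down, such a tree
   exists whose bags of size more than k all miss a member of H; take a minimum
   hitting set X of H, apply induction to H plus a component C of G - X, reroot and
   push that tree into C and X. For a family of connected sets, a deepest root bag
   then hits all members meeting a suitable member S. A local-ratio argument turns
   this into a dual solution of cost at most k times the integral optimum.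

   Lower bound. With m^3 <= k, a path meeting every member of an optimal thicket is
   cut into m segments, each meeting subthickets of hitting size at least t = m^2.
   Two segments cannot be separated by fewer than t vertices, so Menger gives t
   disjoint connected sets joining them. A segment together with one such set towards
   every other segment yields m t pairwise intersecting connected sets covering each
   vertex at most t + m^2 times: the fractional optimum is at least m/2, the integral
   one is 1. *)

(** * Connected sets *)

Section Connectivity.
Variable V : finType.
Implicit Types (g : rel V) (S K X : {set V}).

Lemma connect_exit g K x y : connect g x y -> x \in K -> y \notin K ->
  exists u v, [/\ g u v, u \in K & v \notin K].
Proof.
move=> /connectP[p + ->]; elim: p x => [|z p IHp] x /= => [_ -> //|].
case/andP=> gxz pz xK; case: (boolP (z \in K)) => [zK|zK _]; first exact: IHp.
by exists x, z.
Qed.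

Lemma connect_stable g K x y : (forall u v, g u v -> u \in K -> v \in K) ->
  connect g x y -> x \in K -> y \in K.
Proof.
move=> clK gxy xK; apply: contraT => yK.
have [u [v [guv uK vK]]] := connect_exit gxy xK yK.
by rewrite (clK u v) in vK.
Qed.

Lemma connected_in_exit g S K x y : connected_in g S ->
  x \in S -> x \in K -> y \in S -> y \notin K ->
  exists u v, [/\ g u v, u \in S :&: K & v \in S :\: K].
Proof.
case/andP=> _ /forall_inP cS xS xK yS yK.
have /forall_inP/(_ y yS) cxy := cS x xS.
have [u [v [/and3P[guv uS vS] uK vK]]] := connect_exit cxy xK yK.
by exists u, v; rewrite !inE uK vK uS vS.
Qed.

Lemma induced_sub g S S' : S \subset S' -> subrel (connect (induced g S)) (connect (induced g S')).
Proof.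
move=> /subsetP sS; apply: connect_sub => x y /and3P[gxy xS yS].
by apply: connect1; rewrite /induced gxy !sS.
Qed.

Lemma induced_connect_in g S x y : connect (induced g S) x y -> x \in S -> y \in S.
Proof. by apply: connect_stable => u v /and3P[]. Qed.

Lemma induced_sym g S : symmetric g -> symmetric (induced g S).
Proof. by move=> gs u v; rewrite /induced gs [(u \in S) && _]andbC. Qed.

Lemma connected_inP g S x : symmetric g -> x \in S ->
  (forall y, y \in S -> connect (induced g S) x y) -> connected_in g S.
Proof.
move=> gs xS cS; apply/andP; split; first by apply/set0Pn; exists x.
apply/forall_inP=> y yS; apply/forall_inP=> z zS.
apply: connect_trans (cS z zS); rewrite sym_connect_sym ?cS //.
exact: induced_sym.
Qed.

Lemma connected_in_connect g S x y : connected_in g S -> x \in S -> y \in S ->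
  connect (induced g S) x y.
Proof. by case/andP=> _ /forall_inP cS xS yS; have /forall_inP := cS x xS; apply. Qed.

Lemma connected_inU g S S' x y : symmetric g -> connected_in g S -> connected_in g S' ->
  x \in S -> y \in S' -> (x == y) || g x y -> connected_in g (S :|: S').
Proof.
move=> gs cS cS' xS yS' xy; apply: (@connected_inP _ _ x); rewrite ?inE ?xS // => z.
rewrite inE => /orP[zS|zS].
  by apply: (induced_sub (subsetUl _ _)); apply: connected_in_connect.
apply: (@connect_trans _ _ y).
  case/orP: xy => [/eqP->//|gxy]; apply: connect1.
  by rewrite /induced gxy !inE xS yS' orbT.
by apply: (induced_sub (subsetUr _ _)); apply: connected_in_connect.
Qed.

Lemma connected_in1 g x : connected_in g [set x].
Proof.
apply/andP; split; first by apply/set0Pn; exists x; rewrite inE.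
by apply/forall_inP=> y /set1P->; apply/forall_inP=> z /set1P->; apply: connect0.
Qed.

Lemma connected_in_subrel g g' S : subrel g g' -> connected_in g S -> connected_in g' S.
Proof.
move=> sg /andP[S0 cS]; rewrite /connected_in S0; apply/forall_inP=> x xS.
apply/forall_inP=> y yS; have /forall_inP/(_ y yS) := forall_inP cS x xS.
by apply: connect_sub => u v /and3P[/sg guv uS vS]; apply: connect1; rewrite /induced guv uS.
Qed.

Lemma not_disjointP S S' : reflect (exists2 x, x \in S & x \in S') (~~ [disjoint S & S']).
Proof.
rewrite -setI_eq0; apply: (iffP (set0Pn _)) => [[x /setIP[]]|[x xS xS']]; first by exists x.
by exists x; rewrite inE xS.
Qed.

End Connectivity.

(** * Vine decompositions *)

Section Vine.
Variables (V : finType) (e : rel V).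
Hypothesis esym : symmetric e.
Implicit Types (B C S U X : {set V}) (H : {set {set V}}).

(* A large bag is tolerated as long as it misses a member of the thicket [H]. *)
Definition admissible k H B := (#|B| <= k) || [exists S in H, [disjoint S & B]].

(* A tree with support [U] and root bag [B] may be linked by an edge to one with
   support [U'] and root bag [B']. Unlike in a tree decomposition, an edge of the
   graph may run between two adjacent bags. *)
Definition joinable U B U' B' :=
  (forall u, (u \in U) && (u \in U') ==> (u \in B) && (u \in B')) /\
  forall u v, [&& u \in U, u \notin U', v \in U', v \notin U & e u v] ==>
    (u \in B) && (v \in B').

(* [vine adm U B]: the part [U] of the graph has a tree of admissible bags with
   union [U], rooted at the bag [B]. *)
Inductive vine (adm : pred {set V}) : {set V} -> {set V} -> Prop :=
| vine_leaf B : adm B -> vine adm B B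
| vine_link U B U' B' : vine adm U B -> vine adm U' B' -> joinable U B U' B' ->
    vine adm (U :|: U') B.

Lemma vine_root_sub adm U B : vine adm U B -> forall u, (u \in B) ==> (u \in U).
Proof.
by elim=> // [{}B _ u|{}U {}B U' B' _ sB _ _ _ u]; rewrite ?implybb // inE;
  case: (u \in B) (sB u) => //= ->.
Qed.

Lemma vine_root_adm adm U B : vine adm U B -> adm B.
Proof. by elim. Qed.

Ltac mem_cases := rewrite ?inE; repeat match goal with
  | |- context [?z \in ?A] => case: (z \in A) => //=
  end.

Ltac specialize_at u v := repeat match goal with
  | H : forall x, is_true (implb (x \in _) _) |- _ => move: (H u) (H v); clear H
  | H : forall x, is_true (implb ((x \in _) && _) _) |- _ => move: (H u) (H v); clear H
  end.

Ltac solve_joinable :=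
  let u := fresh "u" in let v := fresh "v" in
  split=> [u|u v];
  [ specialize_at u u
  | repeat match goal with
    | H : forall x y, is_true (implb ((x \in _) && _) _) |- _ =>
        move: (H u v) (H v u); rewrite ?(esym v u); clear H
    end; case: (e u v); rewrite ?andbF ?andbT //=; specialize_at u v ];
  clear; mem_cases.

(* A vine for weak bags is either a vine for strong bags or can be rerooted at a
   weak bag. The attached [U2] makes the induction work: several subtrees hanging
   from the root are merged into one through a duplicate of the root bag. *)
Lemma vine_reroot (adm adm' : pred {set V}) U B : vine adm' U B ->
  vine adm U B \/
  exists s, [/\ adm' s, ~~ adm s &
    forall U2 B2, vine adm' U2 B2 -> joinable U B U2 B2 -> vine adm' (U :|: U2) s].
Proof.
elim=> {U B} [B aB|U B U' B' vU IH vU' IH' jn].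
  case: (boolP (adm B)) => [aB'|aB']; first by left; apply: vine_leaf.
  right; exists B; split=> // U2 B2 v2 j2; apply: vine_link j2 => //.
  exact: vine_leaf.
have sB := vine_root_sub vU; have sB' := vine_root_sub vU'.
have [sI jn1] := jn.
case: IH => [aU|[s [as1 as2 IH]]]; last first.
  right; exists s; split=> // U2 B2 v2 [sI2 j2]; have sB2 := vine_root_sub v2.
  (* A second copy of the root bag [B] gathers [U'] and [U2], so that a single tree is attached to
     [U]. *)
  have -> : U :|: U' :|: U2 = U :|: (B :|: U' :|: U2).
    by apply/setP=> z; rewrite !inE; case: (z \in B) (sB z) => //= [->|_]; rewrite ?orbA.
  apply: (IH _ B).
    apply: (@vine_link _ _ _ _ B2) => //; first apply: (@vine_link _ _ _ _ B') => //.
    - exact/vine_leaf/(vine_root_adm vU).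
    - solve_joinable.
    - solve_joinable.
  solve_joinable.
case: IH' => [aU'|[s [as1 as2 IH']]]; first by left; apply: vine_link jn.
(* The new root lies in the child: seen from there, [U] carrying [U2] is the tree attached at
   [B']. *)
right; exists s; split=> // U2 B2 v2 [sI2 j2].
rewrite (_ : U :|: U' :|: U2 = U' :|: (U :|: U2)); last by rewrite setUCA setUA.
apply: (IH' _ B); first apply: vine_link v2 _ => //.
  solve_joinable.
solve_joinable.
Qed.

Definition boundary_in U B := forall u v, u \in U -> v \notin U -> e u v -> u \in B.

(** An edge leaving one part either enters the other, hence runs through the linked bags, or leaves
    the whole support through [B]; a vertex of [U'] in [B] lies in both supports and so in [B']. *)
Lemma joinable_boundary adm U B U' B' : vine adm U B -> joinable U B U' B' ->
  boundary_in (U :|: U') B -> boundary_in U B /\ boundary_in U' B'.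
Proof.
move=> /vine_root_sub sB [sI jn1] bd; split=> u v.
  move=> uU vU1 euv; case: (boolP (v \in U')) => vU2.
    have := sI u; rewrite uU; have := jn1 u v; rewrite uU vU1 vU2 euv.
    by case: (u \in U') => /= [_ /andP[]|/andP[]].
  by apply: (bd u v); rewrite ?inE ?uU ?negb_or ?vU1.
move=> uU' vU2 euv; case: (boolP (u \in U)) => uU; first by have := sI u; rewrite uU uU' => /andP[].
case: (boolP (v \in U)) => vU1.
  by have := jn1 v u; rewrite vU1 vU2 uU' uU esym euv => /andP[].
have := bd u v; rewrite !inE uU' orbT negb_or vU1 vU2 => /(_ isT isT euv) uB.
by have := sB u; rewrite uB (negPf uU).
Qed.

Section Shift.
Variables (k : nat) (H : {set {set V}}) (C X s : {set V}).
Hypothesis connH : forall S, S \in H -> connected_in e S.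
Hypothesis hitX : hitting H X.
Hypothesis minX : forall Y, hitting H Y -> #|X| <= #|Y|.
Hypothesis leXk : #|X| <= k.
Hypothesis XC : forall u, u \in X -> u \notin C.
Hypothesis bdC : forall u v, u \in C -> e u v -> v \in C :|: X.
Hypothesis hits : hitting H s.
Hypothesis sC : forall u, u \in s -> u \notin C.

(* If shifting enlarged the bag, exchanging [X :&: U] for [B :\: C] would give a
   hitting set smaller than [X]. *)
Lemma admissible_shift B U : boundary_in U B -> (forall u, u \in s -> u \in U -> u \in B) ->
  admissible k (C |: H) B -> admissible k H ((B :&: C) :|: (X :&: U)).
Proof.
move=> bdU sU adB; rewrite /admissible.
case: leqP => //= ltk.
have cX : #|B :&: C| + #|X :&: U| = #|(B :&: C) :|: (X :&: U)|.
  rewrite cardsU (_ : _ :&: _ :&: _ = set0) ?cards0 ?subn0 //.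
  by apply/setP=> z; rewrite !inE; case: (boolP (z \in X)) => [/XC/negPf->|]; rewrite ?andbF.
have cB : #|B :&: C| + #|B :\: C| = #|B| by apply: cardsID.
have leB : #|X :&: U| <= #|B :\: C|.
  rewrite leqNgt; apply/negP=> ltX.
  (* A member [S] missed by this set has its vertices of [X] in [U] and those of [B] in [C]. As it
     meets [s] outside [C :|: U], it leaves [C :|: U] along an edge that starts in [C] and so ends
     in [X], hence in [U]: a contradiction. *)
  have: hitting H ((X :\: U) :|: (B :\: C)).
    apply/forall_inP=> S SH; apply/negP=> dS.
    have nS z : z \in S -> (z \in X -> z \in U) /\ (z \in B -> z \in C).
      move=> zS; have := disjointFl dS zS; rewrite !inE.
      by case: (z \in X); case: (z \in U); case: (z \in B); case: (z \in C).
    have /not_disjointP[x xX xS] := forall_inP hitX S SH.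
    have /not_disjointP[w ws wS] := forall_inP hits S SH.
    have [xU _] := nS x xS; have [_ wC] := nS w wS.
    have wCU : w \notin C :|: U.
      rewrite inE negb_or sC //=; apply/negP=> wU.
      by have := sC ws; rewrite wC // sU.
    have xCU : x \in C :|: U by rewrite inE xU ?orbT.
    have [u [v [euv]]] := connected_in_exit (connH SH) xS xCU wS wCU.
    case/setIP=> uS; rewrite !inE => /orP uCU; rewrite negb_or => /andP[/andP[vC vU] vS].
    have uC : u \in C.
      case: uCU => // uU; have [_] := nS u uS; apply.
      exact: bdU euv.
    have := bdC uC euv; rewrite inE (negPf vC) /= => vX.
    by have [/(_ vX)] := nS v vS; rewrite (negPf vU).
  move/minX; apply/negP; rewrite -ltnNge.
  apply: leq_ltn_trans (leq_card_setU _ _) _.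
  by rewrite -(cardsID U X) addnC ltn_add2r.
have ltB : k < #|B| by apply: leq_trans ltk _; rewrite -cX -cB leq_add2l.
(* The large bag [B] misses [C] or a member of [H]. In the first case the new bag lies in [X] and is
   small. In the second that member misses the new bag too: otherwise it would run from [X :&: U] to
   a vertex of [s] outside [U] and cross [B]. *)
move: adB; rewrite /admissible leqNgt ltB /= => /exists_inP[S].
rewrite inE => /orP[/set1P->|SH dS].
  move=> /pred0P dCB; move: ltk; rewrite -cX (_ : B :&: C = set0) ?cards0 ?add0n.
    by rewrite ltnNge (leq_trans _ leXk) // subset_leq_card // subsetIl.
  by apply/setP=> z; rewrite !inE andbC; apply: dCB.
apply/exists_inP; exists S => //; rewrite -setI_eq0; apply/eqP/setP=> x; rewrite !inE.
apply/negP=> /andP[xS /orP[/andP[xB _]|/andP[_ xU]]]; first by rewrite (disjointFl dS xB) in xS.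
have /not_disjointP[w ws wS] := forall_inP hits S SH.
have wU : w \notin U by apply/negP=> /(sU w ws) wB; rewrite (disjointFl dS wB) in wS.
have [u [v [euv]]] := connected_in_exit (connH SH) xS xU wS wU.
case/setIP=> uS uU /setDP[_ vU].
by have := bdU u v uU vU euv; rewrite (disjointFr dS uS).
Qed.

(* Rooting at a bag [s] that hits [H] but avoids the component [C], every bag is
   pushed into [C :|: X]; [E] is the union of the bags hanging elsewhere from the
   root of the current subtree. *)
Lemma vine_shift U B : vine (admissible k (C |: H)) U B -> forall E,
  boundary_in U B -> boundary_in (U :|: E) B ->
  (forall u, u \in s -> u \in U :|: E -> u \in B) ->
  vine (admissible k H) ((U :&: C) :|: (X :&: (U :|: E))) ((B :&: C) :|: (X :&: (U :|: E))).
Proof.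
elim=> {U B} [B aB|U B U' B' vU IH vU' IH' jn] E bd bdE sE.
  by apply/vine_leaf/admissible_shift.
have sB := vine_root_sub vU; have sB' := vine_root_sub vU'.
have [bdU bdU'] := joinable_boundary vU jn bd.
have [sI jn1] := jn.
(* At the root, [U'] moves into [E]; the child is shifted on its own, with [E] empty. *)
have -> : ((U :|: U') :&: C) :|: (X :&: (U :|: U' :|: E))
    = (U :&: C) :|: (X :&: (U :|: (E :|: U'))) :|: ((U' :&: C) :|: (X :&: U')).
  by apply/setP=> u; mem_cases.
rewrite -[U :|: U' :|: E]setUA [U' :|: E]setUC in bdE sE |- *.
have sE' u : u \in s -> u \in U' -> u \in B'.
  move=> us uU'; have uB : u \in B by apply: sE; rewrite ?inE ?uU' ?orbT.
  by have := sI u; have := sB u; rewrite uB uU' => /= ->.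
apply: (@vine_link _ _ _ _ ((B' :&: C) :|: (X :&: U'))).
- exact: IH.
- by have := IH' set0; rewrite setU0; apply.
split=> [u|u v].
  by have := XC (u:=u); move: (sI u); mem_cases.
move: (bdU' v u) (jn1 u v); rewrite esym; case: (e u v); rewrite ?andbF //=.
mem_cases. all: by do ?[move/(_ isT)].
Qed.

End Shift.

Definition component X z := [set v | connect (induced e (~: X)) z v].

Section Component.
Variables (X : {set V}) (z : V).
Hypothesis zX : z \notin X.

Lemma component_notin v : v \in component X z -> v \notin X.
Proof. by rewrite inE => /induced_connect_in; rewrite !inE; apply. Qed.

Lemma component_boundary u v : u \in component X z -> e u v -> v \in component X z :|: X.
Proof.
move=> uC euv; rewrite inE; case: (boolP (v \in X)) => vX; first by rewrite orbT.
rewrite inE (connect_trans (y := u)) //; first by rewrite inE in uC.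
by apply: connect1; rewrite /induced euv !inE vX component_notin.
Qed.

Lemma component_connected : connected_in e (component X z).
Proof.
have zC : z \in component X z by rewrite inE.
apply: (connected_inP esym zC) => y; rewrite inE => zy.
suff: y \in [set v | connect (induced e (component X z)) z v] by rewrite inE.
apply: connect_stable zy _; last by rewrite inE.
move=> u v /and3P[euv _ vX]; rewrite !inE => zu.
have uC := induced_connect_in zu zC.
apply: (connect_trans zu); apply: connect1; rewrite /induced euv uC /=.
by have := component_boundary uC euv; rewrite inE; rewrite inE in vX; rewrite (negPf vX) orbF.
Qed.

End Component.

Lemma thicketP H : reflect ((forall S, S \in H -> connected_in e S) /\
  (forall S T, S \in H -> T \in H -> exists2 x, x \in S & x \in T)) (thicket e H).
Proof.
apply: (iffP andP) => [[/forall_inP cH /forall_inP iH]|[cH iH]].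
  split=> [S /cH/andP[]//|S T SH TH]; apply/not_disjointP.
  by have /forall_inP := iH S SH; apply.
split; apply/forall_inP=> S SH; first by rewrite cH // andbT; have /andP[] := cH S SH.
by apply/forall_inP=> T TH; apply/not_disjointP/iH.
Qed.

(** Induction on the number of sets outside [H]. Unless a vine of the whole graph turns up on the
    way, each component of the graph minus [X] gets a vine rooted at [X], and these are glued at
    [X]. *)
Lemma vine_exists k : (forall H, thicket e H -> exists2 X, hitting H X & #|X| <= k) ->
  forall H, thicket e H -> exists B, vine (admissible k H) setT B.
Proof.
move=> hit_le H; have [n] := ubnP #|~: H|; elim: n H => // n IHn H ltn tH.
have [cH iH] := thicketP H tH.
have [X0 hX0 leX0] := hit_le H tH.
case: (arg_minnP (fun Y : {set V} => #|Y|) hX0) => X hX minX.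
have leX : #|X| <= k by apply: leq_trans leX0; apply: minX.
have admX : admissible k H X by rewrite /admissible leX.
have step z : z \notin X -> (exists B, vine (admissible k H) setT B) \/
    vine (admissible k H) (X :|: component X z) X.
  move=> zX; set C := component X z.
  have CX := component_notin zX; have bdC := component_boundary zX.
  have cC : connected_in e C := component_connected zX.
  (* If [C] misses a member of [H], it is itself an admissible bag. Otherwise it is a new member of
     the thicket, since [X] hits [H] but misses [C]. *)
  case: (boolP [exists S in H, [disjoint S & C]]) => [dC|/exists_inPn iC].
    right; apply: (@vine_link _ _ _ C C); do ?exact: vine_leaf.
      by apply: vine_leaf; rewrite /admissible dC orbT.
    split=> [u|u v]; last by case: (u \in X) => //=; case: (v \in C); rewrite ?andbF //= implybT.
    by apply/implyP => /andP[uX /CX]; rewrite uX.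
  have CH : C \notin H.
    apply/negP=> /(forall_inP hX)/not_disjointP[x xX /CX]; by rewrite xX.
  have tCH : thicket e (C |: H).
    apply/thicketP; split=> [S|S T]; rewrite !inE; first by case/predU1P=> [->|/cH].
    case/predU1P=> [->|SH] /predU1P[->|TH]; last exact: iH.
    - by exists z; rewrite inE.
    - by have /not_disjointP[x xT xC] := iC T TH; exists x.
    - by have /not_disjointP[x xT xC] := iC S SH; exists x.
  have [|B vB] := IHn (C |: H) _ tCH.
    rewrite -ltnS; apply: leq_trans ltn; rewrite ltnS proper_card // properC properE subsetUr /=.
    by apply/subsetPn; exists C; rewrite ?setU11.
  (* A bag [s] admissible for [C |: H] but not for [H] is large and hits [H], so the member it
     misses is [C], as [vine_shift] requires of the root. *)
  have [vB'|[s [as1 as2 vs]]] := vine_reroot (admissible k H) vB; first by left; exists B.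
  right; move: as2; rewrite negb_or => /andP[/negPf lts /exists_inPn his].
  have hs : hitting H s by apply/forall_inP=> S /his; rewrite disjoint_sym.
  have ds : [disjoint C & s].
    move: as1; rewrite /admissible lts /= => /exists_inP[S]; rewrite inE => /orP[/set1P->//|/his].
    by move/negPf->.
  have vT : vine (admissible k (C |: H)) setT s.
    rewrite -(setTU B); apply: (vs B B).
      exact/vine_leaf/(vine_root_adm vB).
    by split=> [u|u v]; rewrite !inE ?andbb ?implybb //= ?andbF.
  have CX' u : u \in X -> u \notin C by apply: contraL => /CX.
  have sC u : u \in s -> u \notin C by move=> us; rewrite (disjointFl ds us).
  have := @vine_shift k H C X s cH hX minX leX CX' bdC hs sC _ _ vT set0.
  rewrite setU0 setTI setIT setUC (_ : s :&: C = set0) ?set0U; last first.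
    by apply/eqP; rewrite setI_eq0 disjoint_sym.
  by apply=> [u v|u v|u us]; rewrite !inE.
(* The gluing runs over a list of vertices, so a component may come up again; then [K r] already
   contains it. *)
pose K (r : seq V) := [set v | has (fun z => (z \notin X) && (v \in component X z)) r].
have Kcons z r v : z \notin X -> (v \in K (z :: r)) = (v \in component X z) || (v \in K r).
  by move=> zX; rewrite /K !in_set /= zX !in_set.
have all_steps r : (exists B, vine (admissible k H) setT B) \/
    vine (admissible k H) (X :|: K r) X.
  elim: r => [|z r IHr].
    right; rewrite (_ : X :|: K [::] = X); first exact: vine_leaf.
    by apply/setP=> v; rewrite !inE orbF.
  case: IHr => [|vr]; first by left.
  case: (boolP (z \in X)) => zX.
    right; rewrite (_ : K (z :: r) = K r) //.
    by apply/setP=> v; rewrite !inE /= zX.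
  case: (step z zX) => [|vz]; first by left.
  have KX v : v \in K r -> v \notin X.
    by rewrite inE => /hasP[y _ /andP[yX]]; apply: component_notin.
  have bdK u v : u \in K r -> e u v -> v \in K r :|: X.
    rewrite !inE => /hasP[y yr /andP[yX uy]] euv.
    have := component_boundary yX uy euv; rewrite inE => /orP[vy|->]; last by rewrite orbT.
    by apply/orP; left; apply/hasP; exists y; rewrite ?yX.
  case: (boolP (z \in K r)) => zK.
    right; rewrite (_ : K (z :: r) = K r) //.
    apply/setP=> v; rewrite Kcons //.
    case: (boolP (v \in component X z)) => //=; rewrite inE => zv; symmetry.
    apply: connect_stable zv zK => u w /and3P[euw _ wX] uK.
    by have := bdK u w uK euw; move: wX; rewrite !inE => /negPf->; rewrite orbF.
  right; rewrite (_ : X :|: K (z :: r) = (X :|: K r) :|: (X :|: component X z)); last first.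
    by apply/setP=> v; rewrite !in_setU Kcons //; case: (v \in X) => //=; rewrite orbC.
  have dK v : v \in K r -> v \notin component X z.
    move=> vK; apply/negP; rewrite inE sym_connect_sym => [vz'|]; last first.
      exact: induced_sym.
    suff: z \in K r by rewrite (negPf zK).
    apply: connect_stable vz' vK => u w /and3P[euw _ wX] uK.
    by have := bdK u w uK euw; move: wX; rewrite !inE => /negPf->; rewrite orbF.
  apply: (vine_link vr vz); split=> [u|u v]; rewrite !in_setU.
    by have := dK u; case: (u \in X); case: (u \in K r); case: (u \in component X z) =>
      //= /(_ isT).
  apply/implyP=> /and5P[uXK]; rewrite !negb_or => /andP[uX uC] vXC /andP[vX vK] euv.
  move: uXK; rewrite (negPf uX) /= => uK.
  by have := bdK u v uK euv; rewrite inE (negPf vX) (negPf vK).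
case: (all_steps (enum V)) => // vT; exists X; rewrite (_ : setT = X :|: K (enum V)) //.
apply/setP=> v; rewrite !in_setU in_setT; symmetry.
case: (boolP (v \in X)) => //= vX; rewrite inE; apply/hasP; exists v; first by rewrite mem_enum.
by rewrite vX inE connect0.
Qed.

(** * Members whose neighbours are hit by few vertices *)

Section LocalHitting.
Variables (k : nat) (F : {set {set V}}).
Hypothesis connF : forall S, S \in F -> connected_in e S.

Definition locally_hit := exists S X, [/\ S \in F, #|X| <= k &
  forall T, T \in F -> ~~ [disjoint T & S] -> ~~ [disjoint T & X]].

(** Descend to a subtree [U'] containing [S] such that no member lies in [U' :\: B']. A member
    meeting [S] but missing [B'] would have to leave [U'], which is possible only through [B']. With
    the empty thicket, admissible bags have size at most [k]. *)
Lemma vine_locally_hit U B : vine (admissible k set0) U B -> boundary_in U B ->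
  (exists2 S, S \in F & S \subset U :\: B) -> locally_hit.
Proof.
elim=> {U B} [B _ _ [S SF]|U B U' B' vU IH vU' IH' jn bd [S SF sS]].
  by rewrite setDv subset0 => /eqP S0; have /andP[] := connF SF; rewrite S0 eqxx.
have sB := vine_root_sub vU; have sB' := vine_root_sub vU'.
have [bdU bdU'] := joinable_boundary vU jn bd.
have [sI jn1] := jn.
have SU u : u \in S -> (u \in U) || (u \in U') /\ (u \notin B).
  by move/(subsetP sS); rewrite !inE => /andP[-> ->].
case: (boolP (S \subset U)) => [SsU|/subsetPn[y yS yU]].
  by apply: IH => //; exists S => //; apply/subsetP=> u uS; rewrite inE (subsetP SsU) // andbT;
    case: (SU u uS).
have yU' : y \in U' by have [] := SU y yS; rewrite (negPf yU).
case: (boolP [exists T in F, T \subset U' :\: B']) => [/exists_inP[T TF sT]|/exists_inPn nT].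
  by apply: IH' => //; exists T.
have aB' := vine_root_adm vU'.
exists S, B'; split=> //.
  by move: aB'; rewrite /admissible => /orP[//|/exists_inP[T]]; rewrite inE.
(* [S] avoids [B], and every way from [U'] to the rest of [U] passes through [B]. *)
have SU' u : u \in S -> u \in U'.
  move=> uS; apply: contraT => uU'.
  have [a [b [eab]]] := connected_in_exit (connF SF) yS yU' uS uU'.
  case/setIP=> aS aU' /setDP[bS bU'].
  have [aUU aB] := SU a aS; have [bUU bB] := SU b bS; rewrite (negPf bU') orbF in bUU.
  case: (boolP (a \in U)) => aU; first by have := sI a; rewrite aU aU' (negPf aB).
  by have := jn1 b a; rewrite bUU bU' aU' aU esym eab (negPf bB).
move=> T TF /not_disjointP[x xT xS]; apply/negP=> dT.
have TB' u : u \in T -> u \notin B' by move=> uT; rewrite (disjointFr dT uT).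
have := nT T TF; case/subsetPn=> w wT; rewrite !inE TB' //= => wU'.
have [a [b [eab]]] := connected_in_exit (connF TF) xT (SU' x xS) wT wU'.
case/setIP=> aT aU' /setDP[bT bU'].
by have := TB' a aT; rewrite (bdU' a b).
Qed.

End LocalHitting.

Lemma thicket_locally_hit k (F : {set {set V}}) :
  (forall H, thicket e H -> exists2 X, hitting H X & #|X| <= k) ->
  (forall S, S \in F -> connected_in e S) -> F != set0 -> locally_hit k F.
Proof.
move=> hit_le cF /set0Pn[S0 S0F].
have [|B vB] := vine_exists hit_le (H := set0).
  by apply/thicketP; split=> [S|S T]; rewrite inE.
case: (boolP [exists S in F, S \subset setT :\: B]) => [/exists_inP[S SF sS]|/exists_inPn nS].
  by apply: (vine_locally_hit cF vB); [move=> u v; rewrite !inE|exists S].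
(* Every member meets the root bag, so this bag hits the whole family and any member serves as
   [S]. *)
have := vine_root_adm vB; rewrite /admissible => /orP[leB|/exists_inP[T]]; last by rewrite inE.
exists S0, B; split=> // T TF _; have /subsetPn[x xT] := nS T TF.
by rewrite !inE andbT negbK => xB; apply/not_disjointP; exists x.
Qed.

(** * Packings and the local-ratio cover *)

Lemma packing_sub (P Q : {set {set V}}) : Q \subset P -> packing P -> packing Q.
Proof.
move=> /subsetP sQ /forall_inP pP; apply/forall_inP=> S /sQ/pP/forall_inP pS.
by apply/forall_inP=> T /sQ/pS.
Qed.

Lemma packing_setU1 (P : {set {set V}}) S : packing P ->
  (forall T, T \in P -> [disjoint T & S]) -> packing (S |: P).
Proof.
move=> /forall_inP pP dS; apply/forall_inP=> T; rewrite !inE => TSP.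
apply/forall_inP=> T'; rewrite !inE => TSP'; apply/implyP=> nT.
case/predU1P: TSP TSP' nT => [->|TP] /predU1P[->|TP'] nT; do ?exact: dS.
- by rewrite eqxx in nT.
- by rewrite disjoint_sym dS.
- by have /forall_inP/(_ T' TP')/implyP := pP T TP; apply.
Qed.

Lemma leq_rho (v : {set V} -> nat) P : packing P -> \sum_(S in P) v S <= rho v.
Proof.
by move=> pP; rewrite /rho; apply: (@leq_bigmax_cond _ _ (fun P : {set {set V}} =>
  \sum_(S in P) v S)).
Qed.

Lemma rhoP (v : {set V} -> nat) : exists2 P : {set {set V}}, packing P &
  (forall S, S \in P -> v S != 0) /\ rho v = \sum_(S in P) v S.
Proof.
have [|P pP rP] := @eq_bigmax_cond _ (@packing V) (fun P : {set {set V}} => \sum_(S in P) v S).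
  by apply/card_gt0P; exists set0; apply/forall_inP=> S; rewrite inE.
exists [set S in P | v S != 0].
  by apply: packing_sub pP; apply/subsetP=> S; rewrite inE => /andP[].
split=> [S|]; first by rewrite inE => /andP[].
rewrite /rho rP [RHS](eq_bigl (fun S => (S \in P) && (v S != 0))) => [|S]; last by rewrite inE.
by rewrite [LHS](bigID (fun S => v S != 0)) /= [X in _ + X]big1 ?addn0 // => S /andP[_ /negbNE/eqP].
Qed.

(* Local ratio: pay [v S] on a set [X] hitting every profitable coalition that
   meets a suitable [S], and recurse on the reduced game. *)
Theorem cover_exists k (v : {set V} -> nat) :
  (forall H, thicket e H -> exists2 X, hitting H X & #|X| <= k) ->
  (forall S, ~~ connected_in e S -> v S = 0) ->
  exists2 x : V -> nat, (forall S, v S <= \sum_(i in S) x i) &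
    \sum_i x i <= k * rho v.
Proof.
move=> hit_le; have [n] := ubnP #|[set S | v S != 0]|; elim: n v => // n IHn v ltn vC.
set F := [set S | v S != 0] in ltn.
case: (eqVneq F set0) => [F0|F0].
  exists (fun=> 0) => [S|]; last by rewrite big1.
  rewrite big1 // leqn0; apply: contraT => vS; by have : S \in F; [rewrite inE|rewrite F0 inE].
have cF S : S \in F -> connected_in e S by rewrite inE; apply: contraR => /vC ->.
have [S [X [SF leX hX]]] := thicket_locally_hit hit_le cF F0.
(* Subtraction is truncated: [S], which meets [X], drops to 0, so fewer coalitions remain
   profitable. *)
pose v' T := v T - (if [disjoint T & X] then 0 else v S).
have le_v' T : v' T <= v T by apply: leq_subr.
have SX : ~~ [disjoint S & X].
  by apply: hX => //; rewrite -setI_eq0 setIid; have /andP[] := cF S SF.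
have v'S : v' S = 0 by rewrite /v' (negPf SX) subnn.
have [||x' x'v sum_x'] := IHn v'.
- rewrite -ltnS; apply: leq_trans ltn; rewrite ltnS proper_card // properE; apply/andP; split.
    by apply/subsetP=> T; rewrite !inE -!lt0n => /leq_trans-> //.
  by apply/subsetPn; exists S => //; rewrite inE v'S.
- by move=> T /vC vT; apply/eqP; rewrite -leqn0 -vT.
exists (fun i => x' i + (if i \in X then v S else 0)) => [T|].
  rewrite big_split /=.
  suff le_v : v T - v' T <= \sum_(i in T) (if i \in X then v S else 0).
    by apply: leq_trans (leq_add (x'v T) le_v); rewrite -leq_subLR.
  rewrite /v'; case: (boolP [disjoint T & X]) => [_|/not_disjointP[i iT iX]];
    first by rewrite subn0 subnn.
  rewrite (bigD1 i) //= iX; apply: leq_trans (leq_addr _ _).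
  by rewrite leq_subLR addnC -leq_subLR.
(* If a member of an optimal packing for [v'] meets [X], it regains [v S] under [v], its reduced
   value being nonzero. Otherwise no member meets [S], and [S] can be added. *)
have rho_v' : rho v' + v S <= rho v.
  have [P pP [nzP ->]] := rhoP v'.
  case: (boolP [exists T in P, ~~ [disjoint T & X]]) => [/exists_inP[T TP TX]|/exists_inPn nX].
    apply: leq_trans (leq_rho v pP); rewrite (bigD1 T) // [leqRHS](bigD1 T) //= addnAC leq_add //.
      by have := nzP T TP; rewrite /v' (negPf TX); lia.
    by apply: leq_sum => T' _.
  have dS T : T \in P -> [disjoint T & S].
    move=> TP; apply: contraT => dTS; have := nX T TP.
    by rewrite hX // inE -lt0n (leq_trans _ (le_v' T)) // lt0n nzP.
  apply: leq_trans (leq_rho v (packing_setU1 pP dS)).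
  rewrite big_setU1 /=; first by rewrite addnC leq_add2l leq_sum.
  by apply/negP=> /nzP; rewrite v'S.
rewrite big_split /= -big_mkcond sum_nat_const.
apply: leq_trans (leq_add sum_x' (leq_mul leX (leqnn _))) _.
by rewrite -mulnDr leq_mul2l rho_v' orbT.
Qed.

End Vine.

(** * Menger's theorem *)

Section Menger.
Variable V : finType.
Implicit Types (g : rel V) (A B K L P R S X Z : {set V}).

Definition separates g A B X := forall a b, a \in A -> b \in B ->
  a \notin X -> b \notin X -> ~~ connect (induced g (~: X)) a b.

Definition linkage g A B t (Q : 'I_t -> {set V}) :=
  (forall i j, i != j -> [disjoint Q i & Q j]) /\
  forall i, [/\ connected_in g (Q i), ~~ [disjoint Q i & A] & ~~ [disjoint Q i & B]].

Lemma separatesC g A B X : symmetric g -> separates g A B X -> separates g B A X.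
Proof.
move=> gs sX a b aB bA aX bX; rewrite sym_connect_sym; first exact: sX.
exact: induced_sym.
Qed.

Lemma separates_closed g A B X K : (forall a, a \in A -> a \notin X -> a \in K) ->
  (forall b, b \in B -> b \notin X -> b \notin K) ->
  (forall u v, g u v -> u \in K -> v \notin X -> v \in K) -> separates g A B X.
Proof.
move=> AK BK clK a b aA bB aX bX; apply/negP=> cab.
have := BK b bB bX; rewrite (connect_stable _ cab) ?AK // => u v /and3P[guv _].
by rewrite inE => vX uK; apply: (clK u).
Qed.

(** A walk from [A] to [B] has a vertex in [x |: S], and up to the first one it stays in [L :|: S];
    so [Z] already cuts it there. *)
Lemma separates_half g A B L S x Z :
  (forall a, a \in A -> a \in L :|: S) -> (forall b, b \in B -> b \notin L) ->
  (forall u v, u \in L -> u != x -> g u v -> v \in L :|: S) ->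
  separates (induced g (L :|: S)) A (x |: S) Z -> separates g A B Z.
Proof.
move=> AL BL clL sZ; set h := induced g (L :|: S) in sZ.
pose K := [set v | (v \notin Z) && [exists a in A, (a \notin Z) && connect (induced h (~: Z)) a v]].
have KP v : v \in K -> v \in L /\ v != x.
  rewrite inE => /andP[vZ /exists_inP[a aA /andP[aZ av]]].
  have vLS : v \in L :|: S.
    by apply: connect_stable av (AL a aA) => u w /and3P[/and3P[]].
  have : v \notin x |: S by apply/negP=> vS; have := sZ a v aA vS aZ vZ; rewrite av.
  by move: vLS; rewrite !inE negb_or => /orP[->|->] /andP[->].
apply: (@separates_closed _ _ _ _ K) => [a aA aZ|b bB bZ|u v guv uK vZ].
- by rewrite inE aZ; apply/exists_inP; exists a; rewrite ?aZ ?connect0.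
- by apply/negP=> /KP[bL _]; have := BL b bB; rewrite bL.
have [uL ux] := KP u uK; have vLS := clL u v uL ux guv.
move: uK; rewrite !inE vZ => /andP[uZ /exists_inP[a aA /andP[aZ au]]].
apply/exists_inP; exists a; rewrite ?aZ //= (connect_trans au) //.
by apply: connect1; rewrite /induced /h /induced guv vLS !inE uL uZ vZ.
Qed.

(** Disjoint sets that all meet [P], as many as [P] has vertices, meet it in one vertex each and can
    be indexed by these vertices. *)
Lemma linkage_label g A P t Q : @linkage g A P t Q -> #|P| = t ->
  exists q : V -> {set V},
   (forall p, p \in P -> [/\ p \in q p, connected_in g (q p) & ~~ [disjoint q p & A]]) /\
   forall p p', p \in P -> p' \in P -> p != p' -> [disjoint q p & q p'].
Proof.
case=> dQ lQ cP.
have /fin_all_exists[f fP] i : exists x, x \in Q i /\ x \in P.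
  by have [_ _ /not_disjointP[x]] := lQ i; exists x.
have injf : injective f.
  move=> i j fij; apply/eqP; apply: contraT => /dQ dij.
  by have [fi _] := fP i; have [fj _] := fP j; rewrite fij (disjointFl dij fj) in fi.
have imf : [set f i | i in 'I_t] = P.
  apply/eqP; rewrite eqEcard card_imset // card_ord cP leqnn andbT.
  by apply/subsetP=> _ /imsetP[i _ ->]; case: (fP i).
have /fin_all_exists[h hP] p : exists i : option 'I_t, p \in P -> omap f i = Some p.
  case: (boolP (p \in P)) => pP; last by exists None.
  by move: pP; rewrite -imf => /imsetP[i _ ->]; exists (Some i).
exists (fun p => if h p is Some i then Q i else set0); split=> [p pP|p p' pP pP' pp'].
  by have := hP p pP; case: (h p) => //= i [<-]; have [fi _] := fP i; have [] := lQ i.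
have := hP p pP; case: (h p) => //= i [ip]; have := hP p' pP'; case: (h p') => //= j [jp].
by apply: dQ; apply: contraNneq pp' => ij; rewrite -ip -jp ij.
Qed.

Lemma linkage_sub g g' A B t Q : subrel g g' -> @linkage g A B t Q -> linkage g' A B Q.
Proof.
by move=> sg [dQ lQ]; split=> // i; have [cQ] := lQ i; split=> //; apply: connected_in_subrel cQ.
Qed.

(* Goering's induction: if deleting the edge [x y] creates a small separator [S],
   link [A] to [x |: S] on one side and [y |: S] to [B] on the other. *)
Theorem menger g A B t : symmetric g ->
  (forall X, separates g A B X -> t <= #|X|) -> exists Q, @linkage g A B t Q.
Proof.
have [n] := ubnP #|[set p : V * V | g p.1 p.2 && (p.1 != p.2)]|.
elim: n g A B => // n IHn g A B ltn gs sep_ge.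
case: (set_0Vmem [set p : V * V | g p.1 p.2 && (p.1 != p.2)]) => [noedge|[[x0 y0]]].
  (* With no edges but loops, [A :&: B] separates, and its vertices form a linkage of singletons. *)
  have leAB : t <= #|A :&: B|.
    apply: sep_ge; apply: (@separates_closed _ _ _ _ A) => // [b bB|u v guv uA vAB].
      by rewrite inE bB andbT.
    have : (u, v) \notin [set p : V * V | g p.1 p.2 && (p.1 != p.2)] by rewrite noedge inE.
    by rewrite inE /= guv /= negbK => /eqP<-.
  exists (fun i => [set enum_val (widen_ord leAB i)]); split=> [i j ij|i].
    rewrite disjoints1 inE (inj_eq enum_val_inj); apply: contraNneq ij => /(congr1 val)/= ij.
    exact/eqP/val_inj.
  have := enum_valP (widen_ord leAB i); rewrite inE => /andP[iA iB].
  by split; rewrite ?disjoints1 ?negbK //; apply: connected_in1.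
rewrite inE /= => /andP[gxy0 xy0].
pose g' u v := g u v && ~~ ((u == x0) && (v == y0) || (u == y0) && (v == x0)).
have gs' : symmetric g'.
  by move=> u v; rewrite /g' gs orbC [(v == y0) && _]andbC [(v == x0) && _]andbC.
have lt_edges h : subrel h g -> ~~ h x0 y0 ->
    #|[set p : V * V | h p.1 p.2 && (p.1 != p.2)]| < n.
  move=> sh hxy; rewrite -ltnS; apply: leq_trans ltn; rewrite ltnS proper_card // properE.
  apply/andP; split; first by apply/subsetP=> p; rewrite !inE => /andP[/sh-> ->].
  by apply/subsetPn; exists (x0, y0); rewrite !inE /= ?gxy0 ?xy0 // (negPf hxy).
case: (boolP [exists X : {set V}, (#|X| < t) &&
    [forall a in A :\: X, forall b in B :\: X, ~~ connect (induced g' (~: X)) a b]]); last first.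
  move=> /existsPn nX; have [||X sX|Q lQ] := IHn g' A B => //.
  - by apply: lt_edges => [u v /andP[]//|]; rewrite /g' !eqxx /= andbF.
  - rewrite leqNgt; apply/negP=> ltX; have := nX X; rewrite ltX => /negP; apply.
    apply/forall_inP=> a /setDP[aA aX]; apply/forall_inP=> b /setDP[bB bX]; exact: sX.
  by exists Q; apply: linkage_sub lQ => u v /andP[].
case/existsP=> S /andP[ltS /forall_inP sS].
pose L := [set v | (v \notin S) && [exists a in A,
  (a \notin S) && connect (induced g' (~: S)) a v]].
pose R := ~: (L :|: S).
have AL a : a \in A -> a \in L :|: S.
  move=> aA; rewrite !inE; case: (boolP (a \in S)) => aS; rewrite ?orbT //= orbF.
  by apply/exists_inP; exists a; rewrite ?aS ?connect0.
have BL b : b \in B -> b \notin L.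
  move=> bB; apply/negP; rewrite inE => /andP[bS /exists_inP[a aA /andP[aS ab]]].
  have := sS a; rewrite inE aA aS => /(_ isT)/forall_inP/(_ b); rewrite inE bB bS => /(_ isT).
  by rewrite ab.
have clL u v : u \in L -> g' u v -> v \in L :|: S.
  rewrite !inE => /andP[uS /exists_inP[a aA /andP[aS au]]] guv.
  case: (boolP (v \in S)) => vS; rewrite ?orbT //= orbF.
  apply/exists_inP; exists a; rewrite ?aS //= (connect_trans au) //.
  by apply: connect1; rewrite /induced guv !inE uS vS.
have LS u : u \in L -> u \notin S by rewrite inE => /andP[].
have LR u v : u \in L -> v \in R -> g u v -> (u, v) = (x0, y0) \/ (u, v) = (y0, x0).
  move=> uL vR guv; have : ~~ g' u v.
    by apply/negP=> /(clL u v uL); apply/negP; rewrite -in_setC.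
  by rewrite /g' guv negbK => /orP[]/andP[/eqP-> /eqP->]; [left|right].
(* [S] is too small to separate in [g], so some edge runs from [L] to [R]; it can only be the
   deleted one, in one of its orientations. *)
have [x [y [xL yR gxy]]] : exists x y, [/\ x \in L, y \in R & g x y].
  case: (boolP [exists x in L, exists y in R, g x y]) => [|/exists_inPn noLR].
    by case/exists_inP=> x xL /exists_inP[y yR gxy]; exists x, y.
  have /sep_ge : separates g A B S; last by rewrite leqNgt ltS.
  apply: (@separates_closed _ _ _ _ L) => [a aA aS|b bB _|u v guv uL vS]; last 1 first.
  - apply: contraT => vL; have /exists_inPn/(_ v) := noLR u uL.
    by rewrite guv; apply; rewrite in_setC in_setU negb_or vL.
  - by have := AL a aA; rewrite inE (negPf aS) orbF.
  - exact: BL.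
have RP v : (v \in R) = (v \notin L) && (v \notin S) by rewrite in_setC in_setU negb_or.
have xyE u v : u \in L -> v \in R -> g u v -> u = x /\ v = y.
  move=> uL vR guv; case: (LR u v) (LR x y) => // -[uE vE] [] // [xE yE]; subst => //.
    by move: yR; rewrite RP uL.
  by move: yR; rewrite RP uL.
have yLS : y \notin L :|: S by rewrite -in_setC.
have xRS : x \notin R :|: S by rewrite in_setU RP xL LS.
have xyW (W : {set V}) : x0 \in W -> y0 \in W -> (x \in W) && (y \in W).
  by move=> xW yW; case: (LR x y xL yR gxy) => -[-> ->]; rewrite xW yW.
have sx : separates g A B (x |: S).
  apply: (@separates_closed _ _ _ _ (L :\ x)) => [a aA|b bB _|u v guv].
  - rewrite in_setU in_set1 negb_or in_setD1 => /andP[-> aS].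
    by have := AL a aA; rewrite in_setU (negPf aS) orbF.
  - by rewrite in_setD1 negb_and BL ?orbT.
  rewrite in_setU !in_setD1 in_set1 negb_or => /andP[ux uL] /andP[-> vS].
  apply: contraT => /= vL; have vR : v \in R by rewrite RP vL.
  by have [uE _] := xyE u v uL vR guv; rewrite uE eqxx in ux.
have cS : #|x |: S| = t.
  by apply/eqP; rewrite eqn_leq sep_ge // andbT cardsU1; case: (x \in S); rewrite /= ?add1n // ltnW.
have cS' : #|y |: S| = t.
  by rewrite -cS !cardsU1 (LS x) //; move: yLS; rewrite in_setU negb_or => /andP[_ ->].
have [||Z sZ|Q1 lQ1] := IHn (induced g (L :|: S)) A (x |: S).
- apply: lt_edges => [u v /and3P[]//|]; apply/negP=> /and3P[_ xW yW].
  by have := xyW _ xW yW; rewrite (negPf yLS) andbF.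
- exact: induced_sym.
- apply/sep_ge/(separates_half AL BL _ sZ) => u v uL ux guv; apply: contraT.
  by rewrite -in_setC => vR; have [uE _] := xyE u v uL vR guv; rewrite uE eqxx in ux.
have [||Z sZ|Q2 lQ2] := IHn (induced g (R :|: S)) B (y |: S).
- apply: lt_edges => [u v /and3P[]//|]; apply/negP=> /and3P[_ xW yW].
  by have := xyW _ xW yW; rewrite (negPf xRS).
- exact: induced_sym.
- apply/sep_ge/separatesC => //; apply: separates_half sZ => [b bB|a aA|u v uR uy guv].
  + by have := BL b bB; rewrite in_setU RP => ->; case: (b \in S).
  + by have := AL a aA; rewrite in_setU RP; case: (a \in L) => //= ->.
  + apply: contraT; rewrite in_setU RP negb_or negb_and !negbK => /andP[/orP[vL|->//] _].
    by have [_ uE] := xyE v u vL uR ltac:(by rewrite gs); rewrite uE eqxx in uy.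
have [q1 [q1P dq1]] := linkage_label lQ1 cS.
have [q2 [q2P dq2]] := linkage_label lQ2 cS'.
have side W z p q : connected_in (induced g W) q -> p \in q -> p \in W -> z \in q -> z \in W.
  move=> cq pq pW zq; have := connected_in_connect cq pq zq.
  by move/connect_stable; apply=> // u v /and3P[/and3P[]].
have q1S p z : p \in x |: S -> z \in q1 p -> z \in L :|: S.
  move=> pS zq; have [pq cq _] := q1P p pS; apply: side cq pq _ zq.
  by move: pS; rewrite !in_setU in_set1 => /predU1P[->|->]; rewrite ?xL ?orbT.
have q2S p z : p \in y |: S -> z \in q2 p -> z \in R :|: S.
  move=> pS zq; have [pq cq _] := q2P p pS; apply: side cq pq _ zq.
  by move: pS; rewrite !in_setU in_set1 => /predU1P[->|->]; rewrite ?yR ?orbT.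
(* The two halves share only [S], and in both families a vertex of [S] lies in the set it labels. *)
have meet p p' z : p \in x |: S -> p' \in y |: S -> z \in q1 p -> z \in q2 p' -> p = p'.
  move=> pS pS' z1 z2; have := q1S p z pS z1; have := q2S p' z pS' z2.
  rewrite !in_setU RP => zR zL.
  have zS : z \in S by move: zR zL; case: (z \in L); case: (z \in S).
  have zS1 : z \in x |: S by rewrite in_setU zS orbT.
  have zS2 : z \in y |: S by rewrite in_setU zS orbT.
  have [zq1 _ _] := q1P z zS1; have [zq2 _ _] := q2P z zS2.
  transitivity z; apply/eqP.
    by apply: contraT => /dq1-/(_ pS zS1) d; rewrite (disjointFr d z1) in zq1.
  by apply: contraT => /dq2-/(_ zS2 pS') d; rewrite (disjointFr d zq2) in z2.
(* Sets with the same label in [S] share that vertex; the sets labelled [x] and [y] are joined by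
   the edge between [x] and [y]. *)
pose q2' p := q2 (if p == x then y else p).
have pS2 p : p \in x |: S -> (if p == x then y else p) \in y |: S.
  by rewrite !in_setU !in_set1; case: eqVneq => [_|_] /=; rewrite ?eqxx // => ->; rewrite orbT.
have leS : #|x |: S| >= t by rewrite cS.
pose c i := enum_val (widen_ord leS i).
have cP i : c i \in x |: S by apply: enum_valP.
have cI i j : i != j -> c i != c j.
  by apply: contraNneq => /enum_val_inj/(congr1 val)/= ij; apply/eqP/val_inj.
have meet' i j z : i != j -> z \in q1 (c i) -> z \in q2' (c j) -> False.
  move=> ij z1 z2; have := meet _ _ _ (cP i) (pS2 _ (cP j)) z1 z2.
  case: eqVneq => [_ cy|_ cE]; last by move: (cI i j ij); rewrite cE eqxx.
  move: (cP i); rewrite cy in_setU in_set1; move: yLS; rewrite in_setU negb_or =>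
    /andP[yL /negPf->].
  by rewrite orbF => /eqP yx; rewrite yx xL in yL.
exists (fun i => q1 (c i) :|: q2' (c i)); split=> [i j ij|i].
  rewrite -setI_eq0; apply/eqP/setP=> z; rewrite !inE; apply/negP=> /andP[/orP[zi|zi] /orP[zj|zj]].
  - by rewrite (disjointFr (dq1 _ _ (cP i) (cP j) (cI i j ij)) zi) in zj.
  - exact: meet' ij zi zj.
  - by apply: (meet' j i z) => //; rewrite eq_sym.
  - suff d : [disjoint q2' (c i) & q2' (c j)] by rewrite (disjointFr d zi) in zj.
    apply: dq2; do ?exact: pS2.
    have := cI i j ij; case: (eqVneq (c i) x) => [->|ix]; case: (eqVneq (c j) x) => [_|jx] //.
    + move=> _; apply/eqP=> yc; have := cP j; rewrite -yc in_setU in_set1.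
      move: yLS; rewrite in_setU negb_or => /andP[yL /negPf->]; rewrite orbF.
      by move/eqP=> yx; rewrite yx xL in yL.
    + move=> _; apply/eqP=> yc; have := cP i; rewrite yc in_setU in_set1.
      move: yLS; rewrite in_setU negb_or => /andP[yL /negPf->]; rewrite orbF.
      by move/eqP=> yx; rewrite yx xL in yL.
have [p1 c1 m1] := q1P _ (cP i); have [p2 c2 m2] := q2P _ (pS2 _ (cP i)).
have sub W : subrel (induced g W) g by move=> u v /and3P[].
split.
- apply: (connected_inU gs (connected_in_subrel (sub _) c1) (connected_in_subrel (sub _) c2) p1 p2).
  by case: (eqVneq (c i) x) => [->|_]; rewrite ?eqxx ?gxy ?orbT.
- by have /not_disjointP[z z1 zA] := m1; apply/not_disjointP; exists z; rewrite // inE z1.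
- by have /not_disjointP[z z2 zB] := m2; apply/not_disjointP; exists z; rewrite // inE z2 orbT.
Qed.

End Menger.

(** * The lower bound *)

Section ThicketFamily.
Variables (V : finType) (e : rel V).
Hypothesis esym : symmetric e.
Implicit Types (B P S X : {set V}) (H : {set {set V}}).

Lemma path_induced S x p : path (induced e S) x p = path e x p && ((p == [::]) || all (mem S) (x :: p)).
Proof.
elim: p x => [|y p IHp] x //=; rewrite IHp /induced /=.
by case: (e x y); case: (path e y p); case: (x \in S); case: (y \in S) => //=;
  rewrite ?andbF ?orbF //; case: p {IHp}.
Qed.

Lemma path_connected x p : path e x p -> connected_in e [set z in x :: p].
Proof.
move=> pxp; apply: (@connected_inP _ _ _ x) => // [|y]; first by rewrite inE mem_head.
rewrite inE => yp; apply: (path_connect (p := p)) yp; rewrite path_induced pxp.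
by apply/orP; right; apply/allP=> z zp; rewrite /= inE.
Qed.

(** Extend a path whose last vertex is its only one in some member [B]. An unhit member meets [B]:
    continue inside [B] up to the first vertex of that member. The new piece avoids the old path,
    and the new member takes the place of [B]. *)
Lemma thicket_path H : thicket e H -> H != set0 -> exists x p,
  [/\ path e x p, uniq (x :: p) & forall S, S \in H -> has (mem S) (x :: p)].
Proof.
move=> /(thicketP e)[cH iH] /set0Pn[B0 B0H].
have [y0 y0B] : exists y, y \in B0 by have /andP[/set0Pn] := cH B0 B0H.
suff ext n x p B : path e x p -> uniq (x :: p) -> B \in H -> last x p \in B ->
    (forall z, z \in x :: p -> z \in B -> z = last x p) ->
    #|[set S in H | ~~ has (mem S) (x :: p)]| < n ->
    exists x p, [/\ path e x p, uniq (x :: p) & forall S, S \in H -> has (mem S) (x :: p)].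
  apply: (ext _.+1 y0 [::] B0) => //=.
  by move=> z; rewrite inE => /eqP.
elim: n p B => // n IHn p B pxp up BH yB lastB ltn.
case: (boolP [exists S in H, ~~ has (mem S) (x :: p)]) =>
  [/exists_inP[B' B'H nB']|/exists_inPn hit]; last first.
  by exists x, p; split=> // S /hit/negbNE.
set y := last x p in yB lastB.
have B'p u : u \in x :: p -> u \notin B' by move=> up'; apply: contra nB' => uB'; apply/hasP;
  exists u.
have [z zB zB'] := iH B B' BH B'H.
have /connectP[q0 pq0 zE] := connected_in_connect (cH B BH) yB zB.
case/shortenP: pq0 zE => q pq uq _ zE.
have hq : has (mem B') q.
  apply/hasP; exists z => //; have := mem_last y q; rewrite -zE inE => /predU1P[zy|//].
  by have := B'p y (mem_last _ _); rewrite -zy zB'.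
case/split_find: hq pq uq {zE} => w q1 q2 wB' nq1 pq uq.
have pq' : path (induced e B) y (rcons q1 w) by move: pq; rewrite cat_path => /andP[].
have uq' : uniq (y :: rcons q1 w) by move: uq; rewrite -cat_cons cat_uniq => /andP[].
move: pq'; rewrite path_induced => /andP[pq' /orP[|/allP qB]]; first by case: (q1).
apply: (IHn (p ++ rcons q1 w) B') => //.
- by rewrite cat_path pxp.
- rewrite -cat_cons cat_uniq up; move: uq' => /= /andP[yq ->]; rewrite andbT /=.
  apply/hasPn=> u uq'; apply/negP=> up'; have uB := qB u; rewrite inE uq' orbT in uB.
  by have uy := lastB u up' (uB isT); rewrite uy (negPf yq) in uq'.
- by rewrite last_cat last_rcons.
- move=> u; rewrite -cat_cons mem_cat last_cat last_rcons => /orP[/B'p/negPf->//|].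
  rewrite mem_rcons inE => /predU1P[->//|uq1 uB'].
  by case/hasP: nq1; exists u.
- rewrite -ltnS; apply: leq_trans ltn; rewrite ltnS proper_card // properE; apply/andP; split.
    by apply/subsetP=> S; rewrite !inE -cat_cons has_cat negb_or => /andP[-> /andP[]].
  apply/subsetPn; exists B'; first by rewrite inE B'H nB'.
  by rewrite inE B'H -cat_cons has_cat has_rcons /= (wB' : w \in B') !orbT.
Qed.

(* The members of [H] met by [P] have hitting size at least [t]. *)
Definition heavy H t P := [forall X : {set V}, (#|X| < t) ==>
  [exists S in H, ~~ [disjoint S & P] && [disjoint S & X]]].

Lemma heavyP H t P : reflect (forall X, #|X| < t -> exists S,
  [/\ S \in H, ~~ [disjoint S & P] & [disjoint S & X]]) (heavy H t P).
Proof.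
apply: (iffP forallP) => [hP X ltX|hP X].
  by have /implyP/(_ ltX)/exists_inP[S SH /andP[]] := hP X; exists S.
by apply/implyP=> /hP[S [SH SP SX]]; apply/exists_inP; exists S; rewrite ?SP.
Qed.

Lemma sorted_connected s : s != [::] -> sorted e s -> connected_in e [set z in s].
Proof. by case: s => // x p _; apply: path_connected. Qed.

(** Cut off the shortest prefix that is heavy at level [t]. Without its last vertex [w], fewer than
    [t] vertices hit all members it meets; adding [w] gives at most [t] vertices for the full
    prefix, so the rest stays heavy at level [m * t]. *)
Lemma heavy_segments H t m s : 0 < t -> sorted e s -> uniq s -> heavy H (m * t) [set z in s] ->
  exists P : 'I_m -> {set V},
    (forall i, [/\ connected_in e (P i), P i \subset [set z in s] & heavy H t (P i)]) /\
    forall i j, i != j -> [disjoint P i & P j].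
Proof.
move=> t0; elim: m s => [|m IHm] s es us hs.
  by exists (fun=> set0); split=> [[]|[]].
have ex_l : exists l, heavy H t [set z in take l s].
  exists (size s); rewrite take_size; apply/heavyP=> X ltX.
  by apply: (heavyP _ _ _ hs); rewrite mulSn (leq_trans ltX) ?leq_addr.
case: (ex_minnP ex_l) => l hl minl.
have l0 : 0 < l.
  rewrite lt0n; apply/negP=> /eqP l0; move: hl; rewrite l0 take0 => /heavyP/(_ set0).
  rewrite cards0 => /(_ t0)[S [_ /not_disjointP[z _]]]; by rewrite inE.
case: l => // l in hl minl l0 *.
have ltl : l < size s.
  rewrite ltnNge; apply/negP=> lel; have := minl l; rewrite ltnn take_oversize //.
  by move: hl; rewrite take_oversize ?(leqW lel) // => hl /(_ hl).
have nhl : ~~ heavy H t [set z in take l s] by apply: contraTN (ltnSn l) => /minl; rewrite -leqNgt.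
have [X0 ltX0 hX0] : exists2 X0 : {set V}, #|X0| < t & forall S, S \in H ->
    ~~ [disjoint S & [set z in take l s]] -> ~~ [disjoint S & X0].
  move: nhl => /forallPn[X0]; rewrite negb_imply => /andP[ltX0 /exists_inPn nX0].
  by exists X0 => // S SH Sl; have := nX0 S SH; rewrite Sl.
have [z0 _] : exists z0, z0 \in s by case: (s) ltl => // z s' _; exists z; rewrite mem_head.
set w := nth z0 s l.
have takeE : take l.+1 s = rcons (take l s) w by rewrite (take_nth z0).
have hd : heavy H (m * t) [set z in drop l.+1 s].
  apply/heavyP=> X ltX; have [|S [SH Ss]] := heavyP _ _ _ hs (w |: (X0 :|: X)).
    have := cardsU1 w (X0 :|: X); have := (leq_card_setU X0 X).1; move: ltX ltX0.
    by rewrite mulSn; case: (w \notin _); lia.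
  rewrite -setI_eq0 !setIUr !setU_eq0 !setI_eq0 => /and3P[Sw SX0 SX].
  exists S; split=> //; have /not_disjointP[z zS] := Ss; rewrite inE => zs.
  apply/not_disjointP; exists z => //; move: zs; rewrite inE -[s in z \in s](cat_take_drop l.+1).
  rewrite mem_cat takeE mem_rcons inE => /orP[/predU1P[zw|zl]|//].
    by move: Sw; rewrite disjoint_sym disjoints1 -zw zS.
  have : ~~ [disjoint S & [set z in take l s]] by apply/not_disjointP; exists z; rewrite // inE.
  by move/(hX0 S SH); rewrite SX0.
have [P [P1 P2]] := IHm (drop l.+1 s) (drop_sorted _ es) (drop_uniq _ us) hd.
have sub_take : [set z in take l.+1 s] \subset [set z in s].
  by apply/subsetP=> z; rewrite !inE; apply: mem_take.
have dis i : [disjoint [set z in take l.+1 s] & P i].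
  rewrite -setI_eq0; apply/eqP/setP=> z; rewrite !inE; apply/negP=> /andP[zt zP].
  have [_ /subsetP/(_ z zP)] := P1 i; rewrite inE => zd _.
  move: us; rewrite -[s](cat_take_drop l.+1) cat_uniq => /and3P[_ /hasPn/(_ z zd)].
  by rewrite /= zt.
exists (fun i => if unlift ord0 i is Some j then P j else [set z in take l.+1 s]); split.
  move=> i; case: unliftP => [j _|_].
    have [cP /subsetP sP hP] := P1 j; split=> //; apply/subsetP=> z /sP.
    by rewrite !inE; apply: mem_drop.
  split=> //; apply: sorted_connected; last exact: take_sorted.
  by rewrite takeE; case: (take l s).
move=> i j; case: unliftP => [i' ->|->]; case: unliftP => [j' ->|->].
- by rewrite (inj_eq lift_inj); apply: P2.
- by rewrite disjoint_sym.
- by [].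
- by rewrite eqxx.
Qed.

Lemma hitting_size_le H X : hitting H X -> hitting_size H <= #|X|.
Proof.
move=> hX; rewrite /hitting_size; have : X \in index_enum _ := mem_index_enum X.
elim: (index_enum _) => [|Y r IHr] //; rewrite inE big_cons => /predU1P[<-|/IHr le].
  by rewrite hX geq_minl.
by case: ifP => // _; apply: leq_trans (geq_minr _ _) le.
Qed.

(** The default value [#|V|] of the minimum is attained by [setT], which hits [H] by hypothesis. *)
Lemma hitting_sizeP H : hitting H setT -> exists2 X, hitting H X & #|X| = hitting_size H.
Proof.
move=> hT; rewrite /hitting_size.
elim/big_ind: _ => [|a b [X hX <-] [Y hY <-]|X hX]; last by exists X.
  by exists setT; rewrite ?cardsT.
by case: leqP => _; [exists X|exists Y].
Qed.

Lemma thicket_hit H : thicket e H -> exists2 X, hitting H X & #|X| <= thicket_number e.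
Proof.
move=> tH; have [cH _] := thicketP e H tH.
have [|X hX cX] := @hitting_sizeP H.
  by apply/forall_inP=> S /cH/andP[/set0Pn[x xS] _]; apply/not_disjointP; exists x; rewrite ?inE.
exists X => //; rewrite cX /thicket_number.
exact: (@leq_bigmax_cond _ _ (@hitting_size V)).
Qed.

Lemma thicket_numberP : exists2 H, thicket e H &
  forall X, #|X| < thicket_number e -> exists2 S, S \in H & [disjoint S & X].
Proof.
have [|H tH kH] := @eq_bigmax_cond _ (thicket e) (@hitting_size V).
  by apply/card_gt0P; exists set0; apply/(thicketP e); split=> [S|S T]; rewrite inE.
exists H => // X; rewrite /thicket_number kH => ltX; apply/exists_inP.
apply: contraTT ltX => /exists_inPn nX; rewrite -leqNgt; apply: hitting_size_le.
by apply/forall_inP=> S SH; rewrite disjoint_sym nX.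
Qed.

(** After deleting fewer than [t] vertices, a member meeting [P] and a member meeting [P'] are left
    intact; they intersect, so their union still joins [P] to [P'], and Menger's theorem applies. *)
Lemma heavy_linked H t P P' : thicket e H -> connected_in e P -> connected_in e P' ->
  heavy H t P -> heavy H t P' -> exists Q, @linkage V e P P' t Q.
Proof.
move=> /(thicketP e)[cH iH] cP cP' hP hP'; apply: menger => // X sX; rewrite leqNgt; apply/negP=>
  ltX.
have [S [SH /not_disjointP[a aS aP] SX]] := heavyP _ _ _ hP X ltX.
have [S' [SH' /not_disjointP[b bS bP] SX']] := heavyP _ _ _ hP' X ltX.
have [z zS zS'] := iH S S' SH SH'.
have sub (T : {set V}) : [disjoint T & X] -> T \subset ~: X by rewrite disjoints_subset.
have := sX a b aP bP; rewrite (disjointFr SX aS) (disjointFr SX' bS) => /(_ isT isT)/negP; apply.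
apply: (@connect_trans _ _ z).
  exact/(induced_sub (sub S SX))/(connected_in_connect (cH S SH)).
exact/(induced_sub (sub S' SX'))/(connected_in_connect (cH S' SH')).
Qed.

Lemma connected_in_bigcup (I : finType) P (F : I -> {set V}) (p : pred I) : connected_in e P ->
  (forall i, p i -> connected_in e (F i) /\ ~~ [disjoint F i & P]) ->
  connected_in e (P :|: \bigcup_(i | p i) F i).
Proof.
move=> cP cF; suff [] : connected_in e (P :|: \bigcup_(i | p i) F i) /\ P \subset P :|: \bigcup_(i | p i) F i by [].
elim/big_ind: _ => [|A A' [cA sA] [cA' sA']|i pi]; first by rewrite setU0.
  split; last exact: subsetUl.
  have /set0Pn[x xP] : P != set0 by have /andP[] := cP.
  have -> : P :|: (A :|: A') = (P :|: A) :|: (P :|: A') by rewrite setUACA setUid.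
  by apply: (connected_inU esym cA cA' (x := x) (y := x)); rewrite ?inE ?xP ?eqxx.
split; last exact: subsetUl.
have [ci /not_disjointP[x xF xP]] := cF i pi.
by apply: (connected_inU esym cP ci (x := x) (y := x)); rewrite ?eqxx.
Qed.

Lemma sum_disjoint_le1 n (F : 'I_n -> {set V}) v :
  (forall i j, i != j -> [disjoint F i & F j]) -> \sum_i (v \in F i) <= 1.
Proof.
move=> dF; case: (pickP (fun i => v \in F i)) => [i vi|no]; last by rewrite big1 // => i _;
  rewrite no.
rewrite (bigD1 i) //= vi big1 // => j ji.
by rewrite (disjointFl (dF j i ji) vi).
Qed.

(* The member [(i, a)] is the segment [P i] together with the [a]-th linking sets
   from [P i] to all the other segments. *)
Lemma shallow_thicket m : 0 < m -> m * (m * m) <= thicket_number e ->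
  exists T : 'I_m * 'I_(m * m) -> {set V},
  [/\ forall p, connected_in e (T p), forall p q, ~~ [disjoint T p & T q] &
      forall v, \sum_p (v \in T p) <= 2 * (m * m)].
Proof.
move=> m0 le_m; set t := m * m in le_m *; have t0 : 0 < t by rewrite muln_gt0 m0.
have [H tH heavyH] := thicket_numberP.
have H0 : H != set0.
  have [|S SH _] := heavyH set0; last by apply/set0Pn; exists S.
  by rewrite cards0 (leq_trans _ le_m) // muln_gt0 m0.
have [x [p [pxp uxp hitp]]] := thicket_path tH H0.
have [|P [P1 P2]] := @heavy_segments H t m (x :: p) t0 pxp uxp.
  apply/heavyP=> X ltX; have [S SH SX] := heavyH X (leq_trans ltX le_m).
  exists S; split=> //; have /hasP[z zp zS] := hitp S SH.
  by apply/not_disjointP; exists z; rewrite ?inE.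
have /fin_all_exists[Q QP] (ij : 'I_m * 'I_m) : exists Q, ij.1 != ij.2 ->
  @linkage V e (P ij.1) (P ij.2) t Q.
  case: (eqVneq ij.1 ij.2) => [_|nij]; first by exists (fun=> set0).
  have [ci _ hi] := P1 ij.1; have [cj _ hj] := P1 ij.2.
  by have [Q lQ] := heavy_linked tH ci cj hi hj; exists Q.
pose T (p : 'I_m * 'I_t) := P p.1 :|: \bigcup_(j | p.1 != j) Q (p.1, j) p.2.
have PT i a z : z \in P i -> z \in T (i, a) by move=> zP; rewrite inE zP.
exists T; split=> [[i a]|[i a] [j b]|v].
- apply: connected_in_bigcup => [|j /= ij]; first by have [] := P1 i.
  by have [_ lQ] := QP (i, j) ij; have [] := lQ a.
- apply/not_disjointP; case: (eqVneq i j) => [<-|ij].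
    have [/andP[/set0Pn[z zP] _] _ _] := P1 i.
    by exists z; apply: PT.
  have [_ lQ] := QP (i, j) ij; have [_ _ /not_disjointP[z zQ zP]] := lQ a.
  by exists z; [rewrite inE; apply/orP; right; apply/bigcupP; exists j|apply: PT].
rewrite -(pair_bigA _ (fun i a => nat_of_bool (v \in T (i, a)))) /=.
have leT i a : (v \in T (i, a)) <= (v \in P i) + \sum_(j | i != j) (v \in Q (i, j) a).
  rewrite /T inE /=; case: (v \in P i) => //=; rewrite add0n.
  case: bigcupP => // -[j ij vQ]; by rewrite (bigD1 j) //= vQ.
(* A vertex lies in at most one segment, which contributes [t], and in at most one linking set for
   each ordered pair of segments, which contributes at most [m] for each [i]. *)
apply: (@leq_trans (\sum_i ((v \in P i) * t + m))).
  apply: leq_sum => i _.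
  apply: (@leq_trans (\sum_(a < t) ((v \in P i) + \sum_(j | i != j) (v \in Q (i, j) a)))).
    by apply: leq_sum => a _; apply: leT.
  rewrite big_split /= sum_nat_const card_ord mulnC leq_add2l exchange_big /=.
  apply: (@leq_trans (\sum_(j | i != j) 1)).
    by apply: leq_sum => j ij; have [dQ _] := QP (i, j) ij; apply: sum_disjoint_le1.
  by rewrite sum1_card -[leqRHS]card_ord; apply: max_card.
rewrite big_split /= sum_nat_const card_ord -big_distrl /= mul2n -addnn leq_add2r.
by rewrite -[leqRHS]mul1n leq_mul2r sum_disjoint_le1 ?orbT.
Qed.

End ThicketFamily.

(** * Linear programming *)

HB.instance Definition _ := Monoid.isComLaw.Build R 0%R Rplus
  (fun a b c => esym (Rplus_assoc a b c)) Rplus_comm Rplus_0_l.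

Section RealSums.
Variable I : finType.
Implicit Types (P : pred I) (F G : I -> R).

Lemma rsum_INR P (f : I ->
  nat) : (\big[Rplus/0%R]_(i | P i) INR (f i) = INR (\sum_(i | P i) f i))%R.
Proof. by rewrite (big_morph INR plus_INR (erefl : INR 0 = 0%R)). Qed.

Lemma rsum_mulr P F c : (\big[Rplus/0%R]_(i | P i) (F i * c) = (\big[Rplus/0%R]_(i | P i) F i) * c)%R.
Proof.
by rewrite (big_morph (fun x => x * c)%R (fun x y => Rmult_plus_distr_r x y c) (Rmult_0_l c)).
Qed.

Lemma rsum_le P F G : (forall i, P i -> (F i <= G i)%R) ->
  (\big[Rplus/0%R]_(i | P i) F i <= \big[Rplus/0%R]_(i | P i) G i)%R.
Proof.
move=> leFG; elim/big_rec2: _ => [|i x y Pi xy]; first exact: Rle_refl.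
by apply: Rplus_le_compat => //; apply: leFG.
Qed.

End RealSums.

(** Weak duality: [x] is a solution of the dual covering program. *)
Lemma lp_value_le (V : finType) (v : {set V} -> nat) (x : V -> nat) y :
  (forall S, v S <= \sum_(i in S) x i)%N -> lp_feasible y ->
  (lp_value v y <= INR (\sum_i x i))%R.
Proof.
move=> vx [y0 y1]; apply: (@Rle_trans _ (\big[Rplus/0%R]_(S : {set V}) (\big[Rplus/0%R]_(i in S) (INR (x i) * y S)))%R).
  apply: rsum_le => S _; rewrite rsum_mulr rsum_INR; apply: Rmult_le_compat_r => //.
  exact/le_INR/leP.
rewrite (exchange_big_dep predT) //= -rsum_INR; apply: rsum_le => i _.
under eq_bigr => S _ do rewrite Rmult_comm.
rewrite rsum_mulr -[X in (_ <= X)%R]Rmult_1_l; apply: Rmult_le_compat_r => //.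
exact: pos_INR.
Qed.

(** Every set of the family gets value 1. No two of them are disjoint, so a packing earns at most 1,
    while weight [1/d] on each index is fractionally feasible. *)
Lemma uniform_game (V : finType) (e : rel V) (I : finType) (T : I -> {set V}) d :
  (0 < d)%N -> (0 < #|I|)%N -> (forall p, connected_in e (T p)) ->
  (forall p q, ~~ [disjoint T p & T q]) -> (forall v, \sum_p (v \in T p) <= d)%N ->
  exists v : {set V} -> nat, [/\ coalition_game e v, (rho v <= 1)%N &
    exists2 y, lp_feasible y & lp_value v y = (INR #|I| / INR d)%R].
Proof.
move=> d0 I0 cT iT depth.
pose v S := nat_of_bool [exists p, T p == S].
(* [T] need not be injective, so weights add up over the indices giving the same set. *)
pose mult S := \sum_p (T p == S)%N.
have vmult S : (v S * mult S = mult S)%N.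
  rewrite /v; case: existsP => [_|no]; rewrite ?mul1n // mul0n /mult big1 // => p _.
  by apply/eqP; rewrite eqb0; apply/eqP=> TS; apply: no; exists p; apply/eqP.
have dpos : (0 < INR d)%R by apply/lt_0_INR/ltP.
exists v; split.
- split.
  + rewrite /v; case: existsP => // -[p /eqP Tp].
    by have := cT p; rewrite Tp /connected_in eqxx.
  + by move=> S; rewrite /v; case: existsP => // -[p /eqP <-]; rewrite cT.
  + have /card_gt0P[p _] := I0; exists (T p); rewrite /v.
    by case: existsP => // no; case: no; exists p.
- apply/bigmax_leqP => P /forall_inP pP.
  case: (pickP (fun S => (S \in P) && (v S != 0)%N)) => [S /andP[SP vS]|no]; last first.
    rewrite big1 // => S SP; have := no S; rewrite SP /= => /negbFE/eqP //.
  rewrite (bigD1 S) //= big1 ?addn0; first exact: leq_b1.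
  move=> S' /andP[SP' nS]; apply/eqP; apply: contraNT nS => vS'.
  move: vS vS'; rewrite /v; case: existsP => // -[p /eqP Tp] _; case: existsP => // -[q /eqP Tq] _.
  have /forall_inP/(_ S' SP')/implyP dS := pP S SP.
  rewrite eq_sym; apply: contraT => /dS; rewrite -Tp -Tq => dis.
  by have := iT p q; rewrite dis.
exists (fun S => INR (mult S) * / INR d)%R.
  split=> [S|i].
    by apply: Rmult_le_pos; [apply: pos_INR|apply/Rlt_le/Rinv_0_lt_compat].
  rewrite rsum_mulr rsum_INR /mult.
  apply: (Rmult_le_reg_r (INR d)) => //; rewrite Rmult_assoc Rinv_l; last exact: Rgt_not_eq.
  rewrite Rmult_1_r Rmult_1_l; apply/le_INR/leP.
  rewrite exchange_big /=; apply: leq_trans (depth i); apply: leq_sum => p _.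
  rewrite big_mkcond (bigD1 (T p)) //= eqxx big1 => [|S]; first by case: ifP.
  by rewrite eq_sym => /negPf->; rewrite if_same.
rewrite /lp_value; under eq_bigr => S _ do rewrite -Rmult_assoc -mult_INR multE vmult.
rewrite rsum_mulr rsum_INR /mult exchange_big /=; congr (INR _ * _)%R.
rewrite -sum1_card; apply: eq_bigr => p _.
by rewrite (bigD1 (T p)) //= eqxx big1 // => S; rewrite eq_sym => /negPf->.
Qed.

Lemma cube_root_bounds k : (0 < k)%N -> exists m, [/\ (0 < m)%N, (m * (m * m) <= k)%N &
  (Rpower (INR k) (/ 3) <= INR (2 * m))%R].
Proof.
move=> k0.
have ex : exists m, (m * (m * m) <= k)%N by exists 1%N.
have ub m : (m * (m * m) <= k)%N -> (m <= k)%N.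
  by case: m => // m; apply: leq_trans; rewrite leq_pmulr // muln_gt0.
case: (ex_maxnP ex ub) => m lem maxm.
have m0 : (0 < m)%N by apply: maxm.
exists m; split=> //.
(* Maximality of [m] bounds [k] by the cube of [m + 1], and [m + 1 <= 2 * m]. *)
have ltk : (k <= 2 * m * (2 * m * (2 * m)))%N.
  apply: (@leq_trans (m.+1 * (m.+1 * m.+1))).
    by apply: ltnW; rewrite ltnNge; apply/negP=> /maxm; rewrite ltnn.
  by rewrite !leq_mul // mul2n -addnn -addn1 leq_add2l.
have mpos : (0 < INR (2 * m))%R by apply/lt_0_INR/ltP; rewrite muln_gt0.
apply: (@Rle_trans _ (Rpower (INR (2 * m) ^ 3) (/ 3))%R).
  apply: Rle_Rpower_l; first by apply/Rlt_le/Rinv_0_lt_compat; lra.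
  split; first by apply/lt_0_INR/ltP.
  by move/leP/le_INR: ltk; rewrite -!multE !mult_INR /=; lra.
rewrite -Rpower_pow // Rpower_mult.
have -> : (INR 3 * / 3 = 1)%R by rewrite /=; field.
by rewrite Rpower_1 //; apply: Rle_refl.
Qed.

Theorem theorem3 :
  exists c delta : R, (0 < c)%R /\ (0 < delta)%R /\
  forall (V : finType) (e : rel V),
    symmetric e -> irreflexive e -> (0 < #|V|)%N ->
    (* (i): rho^f <= tau(G) * rho, i.e. every feasible y has value <= tau * rho *)
    (forall v : {set V} -> nat, coalition_game e v ->
       forall y : {set V} -> R, lp_feasible y ->
         (lp_value v y <= INR (thicket_number e) * INR (rho v))%R) /\
    (* (ii): some game with rho^f >= c * tau^delta * rho *)
    (exists v : {set V} -> nat, coalition_game e v /\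
       exists y : {set V} -> R, lp_feasible y /\
         (c * Rpower (INR (thicket_number e)) delta * INR (rho v) <= lp_value v y)%R).
Proof.
(* The fractional solution below has value [m / 2], the integral optimum is at most 1, and the cube
   root of the thicket number is at most [2 * m]; hence the constant 1/4. *)
exists (/ 4)%R, (/ 3)%R; split; [lra|split; [lra|]] => V e es _ V0; split.
  move=> v [_ vC _] y fy.
  have [x vx sum_x] := cover_exists es (@thicket_hit V e) vC.
  apply: Rle_trans (lp_value_le vx fy) _; rewrite -mult_INR.
  exact/le_INR/leP.
(* A single singleton is a thicket that the empty set does not hit. *)
have k0 : (0 < thicket_number e)%N.
  have /card_gt0P[z _] := V0; rewrite lt0n; apply/negP=> /eqP k0.
  have [|X hX] := @thicket_hit V e [set [set z]].
    apply/(thicketP e); split=> [S|S S'] /set1P->; first exact: connected_in1.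
    by move=> /set1P->; exists z; rewrite inE.
  rewrite k0 leqn0 cards_eq0 => /eqP X0; have /forall_inP/(_ [set z]) := hX.
  by rewrite X0 inE eqxx -setI_eq0 set0I eqxx => /(_ isT).
have [m [m0 lem rootm]] := cube_root_bounds k0.
have [T [cT iT depth]] := shallow_thicket es m0 lem.
have [||v [gv rho1 [y fy vy]]] := uniform_game _ _ cT iT depth.
- by rewrite !muln_gt0 m0.
- by rewrite card_prod !card_ord !muln_gt0 m0.
exists v; split=> //; exists y; split=> //; rewrite vy card_prod !card_ord.
have mpos : (0 < INR m)%R by apply/lt_0_INR/ltP.
have -> : (INR (m * (m * m)) / INR (2 * (m * m)) = INR m / 2)%R.
  by rewrite -!multE !mult_INR /=; field; lra.
move/leP/le_INR: rho1 => /= rho1; have rho0 := pos_INR (rho v).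
move: rootm; rewrite -multE mult_INR /= => rootm.
have := exp_pos (/ 3 * ln (INR (thicket_number e)))%R; rewrite -/(Rpower _ _) => root0.
nra.
Qed.
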